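(* Let $z_0=(x_0,\xi_0)\in\mathbb{R}^{2d}\setminus\{0\}$, let $1\le p<\infty$, and let $\Omega\subset\mathbb{R}^{2d}$ be measurable with $0<|\Omega|<\infty$. The supremum $$\sup_{f\in L^2(\mathbb{R}^d)\setminus\{0\}}\frac{\left(\int_\Omega|Q_{\pi(-z_0)}f(z)|^p\,dz\right)^{1/p}}{\|f\|_{L^2}^2}=\sup_{f\in L^2(\mathbb{R}^d)\setminus\{0\}}\frac{|\Omega|^{1/p}|Af(z_0)|}{\|f\|_{L^2}^2}$$ equals $|\Omega|^{1/p}$, but the supremum is not attained.
   Context: $L^2(\mathbb{R}^d)$ is a complex Hilbert space with inner product linear in the first entry. For $z=(x,\xi)\in\mathbb{R}^{2d}$, the time-frequency shift is $\pi(z)f(y)=e^{2\pi i\xi\cdot y}f(y-x)$; for a bounded operator $S$ on $L^2(\mathbb{R}^d)$, $\alpha_z(S)=\pi(z)S\pi(z)^*$ and $Q_Sf(z)=\langle\alpha_z(S)f,f\rangle$; here it is used with $S=\pi(-z_0)$. The ambiguity transform is $Af(x,\xi)=\int_{\mathbb{R}^d}e^{-2\pi i\xi\cdot y}f(y+\tfrac{x}{2})\overline{f(y-\tfrac{x}{2})}\,dy$. *)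

(* Defs.v *)
From HB Require Import structures.
From mathcomp Require Import all_boot all_order all_algebra.
From mathcomp Require Import complex.
From mathcomp Require Import all_classical all_reals all_analysis.

Set Implicit Arguments.
Unset Strict Implicit.
Unset Printing Implicit Defensive.

Import Order.TTheory GRing.Theory Num.Theory.
Import numFieldNormedType.Exports.

Local Open Scope classical_set_scope.
Local Open Scope ring_scope.
Local Open Scope complex_scope.

Definition rV_display : measure_display -> measure_display.
Proof. exact. Qed.

(* The sigma-algebra generated by the coordinates is the Borel sigma-algebra. *)
Section measurable_rV.
Context {R : realType} {n : nat}.

Definition rV_coord (i : 'I_n) (x : 'rV[R]_n) : measurableTypeR R := x 0 i.

Let rV_set0 : g_sigma_preimage rV_coord set0.
Proof. exact: sigma_algebra0. Qed.

Let rV_setC A : g_sigma_preimage rV_coord A -> g_sigma_preimage rV_coord (~` A).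
Proof. exact: sigma_algebraC. Qed.

Let rV_bigcup (F : (set 'rV[R]_n)^nat) :
  (forall i, g_sigma_preimage rV_coord (F i)) ->
  g_sigma_preimage rV_coord (\bigcup_i (F i)).
Proof. exact: sigma_algebra_bigcup. Qed.

HB.instance Definition _ := @isMeasurable.Build (rV_display default_measure_display)
  'rV[R]_n (g_sigma_preimage rV_coord) rV_set0 rV_setC rV_bigcup.

Lemma measurable_coord (i : 'I_n) : measurable_fun [set: 'rV[R]_n] (rV_coord i).
Proof.
move=> _ Y mY; rewrite setTI; apply: sub_sigma_algebra => /=.
rewrite -bigcup_seq/=; exists i => /=; first by rewrite mem_index_enum.
by exists Y => //; rewrite setTI.
Qed.

Lemma measurable_fun_coordP d (T : measurableType d) (f : T -> 'rV[R]_n) :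
  (forall i, measurable_fun [set: T] (rV_coord i \o f)) ->
  measurable_fun [set: T] f.
Proof.
move=> mf.
have prefS : g_sigma_preimage (fun i => rV_coord i \o f) `<=` measurable.
  apply: smallest_sub; first exact: sigma_algebra_measurable.
  rewrite -bigcup_seq; apply: bigcup_sub => i _.
  by move=> A [B mB <-]; exact: mf.
by move=> _ A mA; apply: prefS; rewrite g_sigma_preimage_comp; exists A.
Qed.

End measurable_rV.

Section lebesgue_cons.
Context {R : realType} {n : nat}.

Definition cons_rV (x : measurableTypeR R * 'rV[R]_n) : 'rV[R]_n.+1 :=
  row_mx (x.1)%:M x.2.

Definition uncons_rV (v : 'rV[R]_n.+1) : measurableTypeR R * 'rV[R]_n :=
  (v 0 0, rsubmx (v : 'rV[R]_(1 + n))).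

Lemma cons_rVK : cancel cons_rV uncons_rV.
Proof.
move=> [a v]; rewrite /uncons_rV /cons_rV row_mxKr; congr pair.
by rewrite mxE; case: splitP => // j _; rewrite mxE (ord1 j) eqxx mulr1n.
Qed.

Lemma measurable_cons_rV : measurable_fun [set: _] cons_rV.
Proof.
apply: measurable_fun_coordP => i.
rewrite /comp /rV_coord /cons_rV.
under eq_fun do rewrite mxE.
case: splitP => j _.
  by under eq_fun do rewrite mxE (ord1 j) eqxx mulr1n; exact: measurable_fst.
exact: (measurableT_comp (measurable_coord j) measurable_snd).
Qed.

HB.instance Definition _ :=
  isMeasurableFun.Build _ _ _ _ cons_rV measurable_cons_rV.

Lemma measurable_uncons_rV : measurable_fun [set: _] uncons_rV.
Proof.
apply: measurable_fun_pair; first exact: measurable_coord.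
apply: measurable_fun_coordP => i; rewrite /comp /rV_coord.
under eq_fun do rewrite mxE.
exact: measurable_coord.
Qed.

Variable m : {sigma_finite_measure set 'rV[R]_n -> \bar R}.

Definition lebesgue_cons : set 'rV[R]_n.+1 -> \bar R :=
  pushforward (@lebesgue_measure R \x m)%E cons_rV.

Let lebesgue_cons0 : lebesgue_cons set0 = 0%E.
Proof. exact: measure0. Qed.

Let lebesgue_cons_ge0 A : (0 <= lebesgue_cons A)%E.
Proof. exact: measure_ge0. Qed.

Let lebesgue_cons_sigma_additive : semi_sigma_additive lebesgue_cons.
Proof. exact: measure_semi_sigma_additive. Qed.

HB.instance Definition _ := isMeasure.Build _ _ _ lebesgue_cons
  lebesgue_cons0 lebesgue_cons_ge0 lebesgue_cons_sigma_additive.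

Let lebesgue_cons_sigma_finite : sigma_finite setT lebesgue_cons.
Proof.
have /sigma_finiteP[F [TF ndF Foo]] := sigma_finiteT (@lebesgue_measure R).
have /sigma_finiteP[G [TG ndG Goo]] := sigma_finiteT m.
exists (fun k => uncons_rV @^-1` (F k `*` G k)).
  rewrite -preimage_bigcup predeqE => v; split=> // _.
  have [i _ Fi] : (\bigcup_i F i) (uncons_rV v).1 by rewrite -TF.
  have [j _ Gj] : (\bigcup_i G i) (uncons_rV v).2 by rewrite -TG.
  exists (maxn i j) => //; split.
    by move: Fi; exact/subsetPset/ndF/leq_maxl.
  by move: Gj; exact/subsetPset/ndG/leq_maxr.
move=> k; have [mF Fk] := Foo k; have [mG Gk] := Goo k; split.
  rewrite -[X in measurable X]setTI; apply: measurable_uncons_rV => //.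
  exact: measurableX.
rewrite /lebesgue_cons /pushforward -comp_preimage.
rewrite (_ : _ \o _ = id); last by apply/funext => x; exact: cons_rVK.
by rewrite preimage_id product_measure1E// lte_mul_pinfty// ge0_fin_numE.
Qed.

HB.instance Definition _ := Measure_isSigmaFinite.Build _ _ _ lebesgue_cons
  lebesgue_cons_sigma_finite.

End lebesgue_cons.

(* The n-fold product of the one-dimensional Lebesgue measure, on Borel sets;
   [lebesgue_borel_box] below gives its value on boxes. *)
Fixpoint lebesgue_borel (R : realType) (n : nat) :
    {sigma_finite_measure set 'rV[R]_n -> \bar R} :=
  match n with
  | 0 => \d_ (0 : 'rV[R]_0)
  | n'.+1 => lebesgue_cons (lebesgue_borel R n')
  end.

Lemma measurable_box (R : realType) n (a b : 'rV[R]_n) :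
  measurable [set x : 'rV[R]_n | forall i, a 0 i < x 0 i <= b 0 i].
Proof.
rewrite (_ : [set x | _] =
  \bigcap_(i in [set: 'I_n]) (rV_coord i @^-1` `]a 0 i, b 0 i])); last first.
  apply/seteqP; split=> x /= H i; first by rewrite /= in_itv; move: (H i).
  by have := H i I; rewrite /= in_itv.
apply: fin_bigcap_measurable => // i _.
by rewrite -[X in measurable X]setTI; apply: measurable_coord.
Qed.

Lemma lebesgue_borel_box (R : realType) n (a b : 'rV[R]_n) :
  (forall i, a 0 i <= b 0 i) ->
  lebesgue_borel R n [set x : 'rV[R]_n | forall i, a 0 i < x 0 i <= b 0 i] =
  (\prod_(i < n) (b 0 i - a 0 i))%:E.
Proof.
elim: n a b => [|n IH] a b ab.
  by rewrite big_ord0 /= diracE mem_set// => -[].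
pose a' : 'rV[R]_n := rsubmx (a : 'rV[R]_(1 + n)).
pose b' : 'rV[R]_n := rsubmx (b : 'rV[R]_(1 + n)).
transitivity ((@lebesgue_measure R \x lebesgue_borel R n)%E
  (`]a 0 0, b 0 0] `*` [set x : 'rV[R]_n | forall i, a' 0 i < x 0 i <= b' 0 i])).
  congr (product_measure1 _ _ _); apply/seteqP; split=> -[x v] /=.
    move=> H; split.
      have := H ord0; rewrite mxE; case: splitP => // j _.
      by rewrite mxE (ord1 j) eqxx mulr1n in_itv.
    move=> i; have := H (lift ord0 i); rewrite !mxE.
    case: splitP => [j|j]; first by rewrite (ord1 j).
    move=> /eqP; rewrite /= /bump /= eqSS => /eqP/val_inj <-.
    by rewrite (_ : lift _ _ = rshift 1 i)//; exact: val_inj.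
  move=> [Hx Hv] i; rewrite mxE; case: splitP => j ij.
    have -> : i = 0 by apply: val_inj; rewrite /= ij (ord1 j).
    by move: Hx; rewrite mxE (ord1 j) eqxx mulr1n in_itv.
  by have := Hv j; rewrite !mxE (_ : i = rshift 1 j)//; exact: val_inj.
rewrite product_measure1E//; last exact: measurable_box.
rewrite IH; last by move=> i; rewrite !mxE.
rewrite [X in (X * _)%E](lebesgue_measure_itv `]a 0 0, b 0 0]).
rewrite /= lte_fin big_ord_recl EFinM; congr (_ * _)%E.
  case: ltP => // h; rewrite (_ : b 0 0 = a 0 0) ?subrr//.
  by apply/le_anti; rewrite h ab.
congr EFin; apply: eq_bigr => i _; rewrite !mxE.
by rewrite (_ : lift _ _ = rshift 1 i)//; exact: val_inj.
Qed.

(* The completions of the Borel measures above: the measurable sets of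
   [lebesgue_type] and [phase_type] are the Lebesgue-measurable ones. *)
Section completed.
Context (R : realType) (n : nat).

Definition lebesgue_type := caratheodory_type (lebesgue_borel R n)^*%mu.

Definition lebesgue_rV : set lebesgue_type -> \bar R :=
  @completed_measure_extension _ _ _ (lebesgue_borel R n).

HB.instance Definition _ := Measure.on lebesgue_rV.

Let phase_borel : {measure set ('rV[R]_n * 'rV[R]_n) -> \bar R} :=
  (lebesgue_borel R n \x lebesgue_borel R n)%E.

Definition phase_type := caratheodory_type phase_borel^*%mu.

Definition lebesgue_phase : set phase_type -> \bar R :=
  @completed_measure_extension _ _ _ phase_borel.

HB.instance Definition _ := Measure.on lebesgue_phase.

End completed.
Arguments lebesgue_rV : clear implicits.
Arguments lebesgue_phase : clear implicits.

Section time_frequency.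
Context {R : realType} {d : nat}.
Local Notation E := 'rV[R]_d.
Local Notation C := R[i].
Local Notation leb := (lebesgue_rV R d).

Definition dot (x y : E) : R := \sum_i x 0 i * y 0 i.

(* e^(2 pi i t) *)
Definition expi (t : R) : C := cos (2 * pi * t) +i* sin (2 * pi * t).

Definition cintegral (f : E -> C) : C :=
  (\int[leb]_y complex.Re (f y)) +i* (\int[leb]_y complex.Im (f y)).

Definition L2norm (f : E -> C) : \bar R :=
  ('N[leb]_2%:E [EFin \o @Normc.normc R \o f])%E.

(* L^2(R^d) is handled through representatives, with a.e. equality in place of
   equality of classes. *)
Definition L2 : set (E -> C) :=
  [set f : E -> C | [/\ measurable_fun [set: lebesgue_type R d] (@complex.Re R \o f),
               measurable_fun [set: lebesgue_type R d] (@complex.Im R \o f) &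
               (L2norm f < +oo)%E]].

Definition L2_nonzero : set (E -> C) :=
  [set f : E -> C | L2 f /\ ~ (f = cst 0 %[ae leb])].

Definition inner (f g : E -> C) : C := cintegral (fun y => f y * (g y)^*).

Definition is_adjoint (S T : (E -> C) -> (E -> C)) : Prop :=
  (forall g, L2 g -> L2 (T g)) /\
  (forall f g, L2 f -> L2 g -> inner (S f) g = inner f (T g)).

(* Unique up to a.e. equality; the default value [id] is used only for operators
   that have no adjoint. *)
Definition adjoint (S : (E -> C) -> (E -> C)) : (E -> C) -> (E -> C) :=
  if pselect (exists T, is_adjoint S T) is left h then projT1 (cid h) else id.

Definition tf_shift (z : E * E) (f : E -> C) : E -> C :=
  fun y => expi (dot z.2 y) * f (y - z.1).

(* alpha_z(S) = pi(z) S pi(z)^* *)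
Definition alpha (z : E * E) (S : (E -> C) -> (E -> C)) :
    (E -> C) -> (E -> C) :=
  tf_shift z \o S \o adjoint (tf_shift z).

Definition Qtrans (S : (E -> C) -> (E -> C)) (f : E -> C) (z : E * E) : C :=
  inner (alpha z S f) f.

Definition ambiguity (f : E -> C) (z : E * E) : C :=
  cintegral (fun y =>
    expi (- dot z.2 y) * f (y + 2^-1 *: z.1) * (f (y - 2^-1 *: z.1))^*).

End time_frequency.

(* Main.v *)
Require Import Defs.
From HB Require Import structures.
From mathcomp Require Import all_boot all_order all_algebra.
From mathcomp Require Import complex.
From mathcomp Require Import all_classical all_reals all_analysis.
From mathcomp Require Import measurable_realfun ring lra.

Set Implicit Arguments.
Unset Strict Implicit.
Unset Printing Implicit Defensive.

Import Order.TTheory GRing.Theory Num.Theory.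
Import numFieldNormedType.Exports.

Local Open Scope classical_set_scope.
Local Open Scope ring_scope.

(** For every time-frequency point z, [alpha z] multiplies [pi(- z0)] by a
    unimodular scalar, so |Q f(z)| = |A f(z0)| = |<pi(- z0) f, f>| and both
    quotients equal |Omega|^(1/p) |<pi(- z0) f, f>| / ||f||^2.  Writing
    g = pi(- z0) f and I = <g, f>, the identity
    ||g - c f||^2 = 2 ||f||^2 - 2 Re (c^* I), for a unimodular c with
    c^* I = |I|, gives |I| <= ||f||^2, with equality only if g = c f.
    Such an f vanishes: if x0 <> 0, then |f|^2 is an integrable function
    periodic along x0; if x0 = 0, then f lives on a countable union of parallel
    hyperplanes.  Conversely, pi(- z0) has unimodular (approximate)
    eigenfunctions, whose truncations to cubes bring the quotient arbitrarily
    close to |Omega|^(1/p). *)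

(** * Translation invariance of the completed Lebesgue measure and of its integral *)

Section translation.
Context {R : realType}.

Lemma measurable_translate1 (a : R) :
  measurable_fun [set: measurableTypeR R]
    ((fun x => x + a) : measurableTypeR R -> measurableTypeR R).
Proof. exact: measurable_funD. Qed.

(** The pushforward of Lebesgue measure under the translation agrees with it on half-open intervals,
    which determines it on all Borel sets. *)
Lemma lebesgue_measure_translate (a : R) (A : set (measurableTypeR R)) :
  measurable A ->
  lebesgue_measure ((fun x : measurableTypeR R => x + a) @^-1` A) =
  lebesgue_measure A.
Proof.
move=> mA; apply/esym.
pose phi : {mfun measurableTypeR R >-> measurableTypeR R} :=
  HB.pack (fun x : measurableTypeR R => x + a)
    (isMeasurableFun.Build _ _ _ _ _ (measurable_translate1 a)).
rewrite (lebesgue_measure_unique (mu := pushforward lebesgue_measure phi))//.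
move=> _ [[x y]] _ <-.
rewrite [RHS](_ : _ = @lebesgue_measure R `]x - a, y - a]); last first.
  by congr lebesgue_measure; apply/seteqP; split => z /=; rewrite !in_itv/=;
    lra.
rewrite !lebesgue_measure_itv/= !lte_fin ltrBDr subrK -!EFinB.
by case: ifP => // _; congr EFin; ring.
Qed.

Lemma measurable_translate n (v : 'rV[R]_n) :
  measurable_fun [set: 'rV[R]_n] (fun x : 'rV[R]_n => x + v).
Proof.
apply: measurable_fun_coordP => i; rewrite /comp /rV_coord.
under eq_fun do rewrite mxE.
apply: measurable_funD => //; exact: measurable_coord.
Qed.

Lemma cons_rVD n (x : R) (w : 'rV[R]_n) (v : 'rV[R]_n.+1) :
  cons_rV (x, w) + v = cons_rV (x + v 0 0, w + rsubmx (v : 'rV[R]_(1 + n))).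
Proof.
apply/rowP => i; rewrite !mxE /=; case: splitP => j ij; rewrite !mxE.
  rewrite !(ord1 j) eqxx !mulr1n; congr (_ + v _ _).
  by apply: val_inj; rewrite /= ij (ord1 j).
by congr (_ + v _ _); exact: val_inj.
Qed.

(** Induction on the dimension: the sections over the first coordinate are translates covered by the
    induction hypothesis, and the outer integral is handled by the one-dimensional case. *)
Lemma lebesgue_borel_translate n (v : 'rV[R]_n) (A : set 'rV[R]_n) :
  measurable A ->
  lebesgue_borel R n ((fun x => x + v) @^-1` A) = lebesgue_borel R n A.
Proof.
elim: n v A => [|n IH] v A mA.
  rewrite (_ : _ @^-1` _ = A)//; apply/seteqP.
  by split => x /=; rewrite [v]thinmx0 addr0.
rewrite /= /lebesgue_cons /pushforward/= /product_measure1.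
pose B := cons_rV @^-1` A.
have mB : measurable B.
  by rewrite -[B]setTI; exact: measurable_cons_rV.
pose g x := lebesgue_borel R n (xsection B x).
have mg : measurable_fun setT g by exact: measurable_fun_xsection.
transitivity (\int[lebesgue_measure]_x (g \o (fun x : measurableTypeR R =>
  x + v 0 0)%R) x)%E.
  apply: eq_integral => x _ /=; rewrite /g.
  rewrite -[in RHS](IH (rsubmx (v : 'rV[R]_(1 + n))));
    last exact: measurable_xsection.
  congr (lebesgue_borel R n _).
  apply/seteqP; split => w /=; rewrite /xsection/= !inE /B/= cons_rVD//.
rewrite -[LHS](ge0_integral_pushforward (measurable_translate1 (v 0 0))
  lebesgue_measure measurableT mg)//.
apply: eq_measure_integral => [|mv D mD _]; first exact: measurable_translate1.
exact: lebesgue_measure_translate.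
Qed.

(** The value of [lebesgue_rV] is an infimum over countable Borel covers, and translating a cover
    keeps its total measure. Translating back by [- v] then gives equality. *)
Lemma lebesgue_rV_translate_le n (v : 'rV[R]_n) (A : set 'rV[R]_n) :
  (lebesgue_rV R n ((fun x => x + v)%R @^-1` A) <= lebesgue_rV R n A)%E.
Proof.
apply: le_ereal_inf_tmp => _ [F [mF AF] <-]; apply: ereal_inf_lbound.
exists (fun k => (fun x => x + v) @^-1` F k).
  split; last by move=> x /AF[k _ Fk]; exists k.
  by move=> k; rewrite -[_ @^-1` _]setTI; exact: measurable_translate.
by apply: eq_eseriesr => k _; exact: lebesgue_borel_translate.
Qed.

Lemma lebesgue_rV_translate n (v : 'rV[R]_n) (A : set 'rV[R]_n) :
  lebesgue_rV R n ((fun x => x + v) @^-1` A) = lebesgue_rV R n A.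
Proof.
apply/eqP; rewrite eq_le lebesgue_rV_translate_le/=.
apply: le_trans (lebesgue_rV_translate_le (- v) _); rewrite -comp_preimage.
by rewrite (_ : _ \o _ = id)//; apply/funext => x /=; rewrite subrK.
Qed.

(** Caratheodory's criterion, phrased with [lebesgue_rV] so that its translation invariance on
    arbitrary sets can be used. *)
Lemma lebesgue_measurableP n (A : set 'rV[R]_n) :
  measurable (A : set (lebesgue_type R n)) <->
  forall X : set 'rV[R]_n, lebesgue_rV R n X =
    (lebesgue_rV R n (X `&` A) + lebesgue_rV R n (X `&` ~` A))%E.
Proof. by []. Qed.

(** The test set [X] of Caratheodory's criterion is translated by [- v], split by [A], and the
    pieces are translated back. *)
Lemma measurable_lebesgue_translate n (v : 'rV[R]_n) :
  measurable_fun [set: lebesgue_type R n]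
    ((fun x => x + v) : lebesgue_type R n -> lebesgue_type R n).
Proof.
move=> _ A /lebesgue_measurableP mA; rewrite setTI;
  apply/lebesgue_measurableP => X.
have vK (B : set 'rV[R]_n) : (fun x => x + v) @^-1` ((fun x =>
  x - v) @^-1` B) = B.
  by apply/seteqP; split => x /=; rewrite addrK.
rewrite -(lebesgue_rV_translate (- v)) mA -(lebesgue_rV_translate v).
by rewrite -[X in (_ + X)%E](lebesgue_rV_translate v) !preimage_setI vK.
Qed.

Lemma borel_measurable_lebesgue n (A : set 'rV[R]_n) :
  measurable A -> measurable (A : set (lebesgue_type R n)).
Proof. exact: caratheodory_measurable_mu_ext. Qed.

Lemma lebesgue_rV_borel n (A : set 'rV[R]_n) :
  measurable A -> lebesgue_rV R n A = lebesgue_borel R n A.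
Proof. exact: measurable_mu_extE. Qed.

Lemma borel_measurable_fun_lebesgue n d (T : measurableType d) (f :
  'rV[R]_n -> T) :
  measurable_fun setT f ->
  measurable_fun [set: lebesgue_type R n] (f : lebesgue_type R n -> T).
Proof. by move=> mf _ A mA; apply: borel_measurable_lebesgue; exact: mf. Qed.

Lemma ge0_integral_translate n (v : 'rV[R]_n) (f : 'rV[R]_n -> \bar R) :
  measurable_fun [set: lebesgue_type R n] f -> (forall x, 0 <= f x)%E ->
  (\int[lebesgue_rV R n]_x f (x + v)%R = \int[lebesgue_rV R n]_x f x)%E.
Proof.
move=> mf f0.
have mv := measurable_lebesgue_translate v.
rewrite -[LHS](ge0_integral_pushforward mv (lebesgue_rV R n) measurableT mf)//.
apply: eq_measure_integral => D mD _; exact: lebesgue_rV_translate.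
Qed.

Lemma integral_translate n (v : 'rV[R]_n) (f : 'rV[R]_n -> \bar R) :
  measurable_fun [set: lebesgue_type R n] f ->
  (\int[lebesgue_rV R n]_x f (x + v)%R = \int[lebesgue_rV R n]_x f x)%E.
Proof.
move=> mf; rewrite integralE [RHS]integralE.
congr (_ - _)%E.
  rewrite -[RHS](ge0_integral_translate v (measurable_funepos mf) (funepos_ge0
    f)).
  by apply: eq_integral => x _; rewrite !funeposE.
rewrite -[RHS](ge0_integral_translate v (measurable_funeneg mf) (funeneg_ge0
  f)).
by apply: eq_integral => x _; rewrite !funenegE.
Qed.

Lemma negligible_translate n (v : 'rV[R]_n) (A : set 'rV[R]_n) :
  (lebesgue_rV R n).-negligible A ->
  (lebesgue_rV R n).-negligible ((fun x => x + v) @^-1` A).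
Proof.
move=> [B [mB B0 AB]]; exists ((fun x => x + v) @^-1` B); split => //.
- by have := @measurable_lebesgue_translate n v measurableT B mB; rewrite setTI.
- by rewrite lebesgue_rV_translate.
- by move=> x /AB.
Qed.

Lemma ae_translate n (v : 'rV[R]_n) (P : set 'rV[R]_n) :
  (\forall x \ae lebesgue_rV R n, P x) ->
    \forall x \ae lebesgue_rV R n, P (x + v).
Proof. exact: negligible_translate. Qed.

End translation.

Lemma le_integrable_EFin {disp} {T : measurableType disp} {R : realType}
    (mu : {measure set T -> \bar R}) (f g : T -> R) :
  measurable_fun setT f -> (forall y, `|f y| <= g y) ->
  mu.-integrable setT (EFin \o g) -> mu.-integrable setT (EFin \o f).
Proof.
move=> mf fg; apply: le_integrable => //; first exact/measurable_EFinP.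
move=> y _ /=; rewrite lee_fin [leRHS]ger0_norm//.
exact: le_trans (normr_ge0 _) (fg y).
Qed.

(** * Squared moduli and real and imaginary parts of complex numbers *)

Section complex_algebra.
Context {R : realType}.
Local Notation C := R[i].
Local Open Scope complex_scope.

(** The squared modulus, as a real polynomial within reach of [ring] and [nra] and free of square
    roots. *)
Definition sqn (z : C) : R := complex.Re z ^+ 2 + complex.Im z ^+ 2.

Lemma sqn_ge0 z : 0 <= sqn z.
Proof. by rewrite addr_ge0// sqr_ge0. Qed.

Lemma sqn_eq0 z : (sqn z == 0) = (z == 0).
Proof.
by case: z => a b; rewrite /sqn/= paddr_eq0 ?sqr_ge0// !sqrf_eq0 eq_complex.
Qed.

Lemma sqr_normcE z : Normc.normc z ^+ 2 = sqn z.
Proof. by case: z => a b; rewrite /Normc.normc sqr_sqrtr// addr_ge0// sqr_ge0.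
  Qed.

Lemma normc_ge0 (z : C) : 0 <= Normc.normc z.
Proof. by case: z => a b; exact: sqrtr_ge0. Qed.

Lemma sqnM z w : sqn (z * w) = sqn z * sqn w.
Proof. by case: z w => a b [a' b']; rewrite /sqn/=; ring. Qed.

Lemma sqnJ z : sqn z^*%C = sqn z.
Proof. by case: z => a b; rewrite /sqn/=; ring. Qed.

Lemma mulJc z : z * z^*%C = (sqn z)%:C.
Proof. by case: z => a b; apply/eqP; rewrite eq_complex/= /sqn/=; apply/andP;
  split; apply/eqP; ring. Qed.

Lemma cReM (z w : C) : complex.Re (z * w) =
  complex.Re z * complex.Re w - complex.Im z * complex.Im w.
Proof. by case: z w => a b [a' b']. Qed.

Lemma cImM (z w : C) : complex.Im (z * w) =
  complex.Re z * complex.Im w + complex.Im z * complex.Re w.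
Proof. by case: z w => a b [a' b']. Qed.

Lemma cReB (z w : C) : complex.Re (z - w) = complex.Re z - complex.Re w.
Proof. by case: z w => a b [a' b']. Qed.

Lemma cImB (z w : C) : complex.Im (z - w) = complex.Im z - complex.Im w.
Proof. by case: z w => a b [a' b']. Qed.

Lemma cReJ (z : C) : complex.Re z^*%C = complex.Re z.
Proof. by case: z. Qed.

Lemma cImJ (z : C) : complex.Im z^*%C = - complex.Im z.
Proof. by case: z. Qed.

Lemma conjcM (z w : C) : (z * w)^*%C = z^*%C * w^*%C.
Proof. exact: rmorphM. Qed.

Lemma conjcB (z w : C) : (z - w)^*%C = z^*%C - w^*%C.
Proof. exact: rmorphB. Qed.

Lemma eq_complexP (z w : C) :
  complex.Re z = complex.Re w -> complex.Im z = complex.Im w -> z = w.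
Proof. by case: z w => a b [a' b'] /= -> ->. Qed.

(** A form of Young's inequality; with its twin for imaginary parts it makes a product of two
    square-integrable functions integrable. *)
Lemma norm_ReM_le (z w : C) : `|complex.Re (z * w)| <= sqn z + sqn w.
Proof.
case: z w => a b [a' b']; rewrite /sqn/=.
have := sqr_ge0 (a - a'); have := sqr_ge0 (a + a').
have := sqr_ge0 (b - b'); have := sqr_ge0 (b + b').
by rewrite ler_norml; nra.
Qed.

Lemma norm_ImM_le (z w : C) : `|complex.Im (z * w)| <= sqn z + sqn w.
Proof.
case: z w => a b [a' b']; rewrite /sqn/=.
have := sqr_ge0 (a - b'); have := sqr_ge0 (a + b').
have := sqr_ge0 (b - a'); have := sqr_ge0 (b + a').
by rewrite ler_norml; nra.
Qed.

(** Take c = z / |z|, and c = 1 when z = 0. *)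
Lemma unimodular_Re (z : C) : exists2 c : C, sqn c = 1 &
  complex.Re (c^*%C * z) = Normc.normc z.
Proof.
have [->|z0] := eqVneq z 0.
  by exists 1; rewrite ?mulr0 /sqn/= ?expr1n ?expr0n/= ?addr0 ?mul0r ?sqrtr0.
have n0 : Normc.normc z != 0 by apply: contra_neq z0; exact: Normc.eq0_normc.
have nz := sqr_normcE z.
exists (z * ((Normc.normc z)^-1)%:C).
  rewrite sqnM -nz /sqn/= expr0n addr0 exprVn mulfV// sqrf_eq0//.
move: nz n0; case: z {z0} => a b; rewrite /sqn /= => nz n0.
apply: (mulfI n0); rewrite -expr2 nz; field.
by rewrite n0.
Qed.

End complex_algebra.

(** * Square-integrable complex functions and the equality case of Cauchy-Schwarz *)

Section square_integrable.
Context {disp : measure_display} {T : measurableType disp} {R : realType}.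
Variable mu : {measure set T -> \bar R}.
Local Notation C := R[i].
Local Open Scope complex_scope.
Implicit Types f g h : T -> C.

Definition cmeasurable f :=
  measurable_fun [set: T] (@complex.Re R \o f) /\
  measurable_fun [set: T] (@complex.Im R \o f).

(** The squared L^2 norm written without a root; [L2norm_sqr] relates it to [L2norm]. *)
Definition mass f : \bar R := (\int[mu]_y (sqn (f y))%:E)%E.

Definition square_integrable f := cmeasurable f /\ (mass f < +oo)%E.

(** The analogue of [cintegral] on any measure space; for [lebesgue_rV] the two agree by
    unfolding. *)
Definition cint f : C :=
  (\int[mu]_y complex.Re (f y)) +i* (\int[mu]_y complex.Im (f y)).

Lemma cmeasurable_cst c : cmeasurable (cst c).
Proof. by split; exact: measurable_cst. Qed.

Lemma cmeasurableM f g : cmeasurable f -> cmeasurable g ->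
  cmeasurable (fun y => f y * g y).
Proof.
move=> [mf1 mf2] [mg1 mg2]; split; rewrite /comp.
  under eq_fun do rewrite cReM.
  by apply: measurable_funB; exact: measurable_funM.
under eq_fun do rewrite cImM.
by apply: measurable_funD; exact: measurable_funM.
Qed.

Lemma cmeasurableB f g : cmeasurable f -> cmeasurable g ->
  cmeasurable (fun y => f y - g y).
Proof.
move=> [mf1 mf2] [mg1 mg2]; split; rewrite /comp.
  by under eq_fun do rewrite cReB; exact: measurable_funB.
by under eq_fun do rewrite cImB; exact: measurable_funB.
Qed.

Lemma cmeasurableJ f : cmeasurable f -> cmeasurable (fun y => (f y)^*%C).
Proof.
move=> [mf1 mf2]; split; rewrite /comp.
  by under eq_fun do rewrite cReJ.
by under eq_fun do rewrite cImJ; exact: measurable_funN.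
Qed.

Lemma measurable_sqn f : cmeasurable f ->
  measurable_fun [set: T] (fun y => sqn (f y)).
Proof.
by move=> [mf1 mf2]; apply: measurable_funD; exact: measurable_funX.
Qed.

Lemma mass_ge0 f : (0 <= mass f)%E.
Proof. by apply: integral_ge0 => y _; rewrite lee_fin sqn_ge0. Qed.

Lemma sqint_mass f : square_integrable f -> mass f = (fine (mass f))%:E.
Proof. by case => _ fy; rewrite fineK// ge0_fin_numE// mass_ge0. Qed.

Lemma integrable_sqn f : square_integrable f ->
  mu.-integrable setT (EFin \o (fun y => sqn (f y))).
Proof.
case => mf fy; apply/integrableP; split.
  exact/measurable_EFinP/measurable_sqn.
rewrite (eq_integral (fun y : T => (sqn (f y))%:E))// => y _ /=.
by rewrite ger0_norm// sqn_ge0.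
Qed.

Lemma integrable_sqnD f g : square_integrable f -> square_integrable g ->
  mu.-integrable setT (EFin \o (fun y => sqn (f y) + sqn (g y))).
Proof.
move=> Lf Lg; apply: eq_integrable (integrableD measurableT
  (integrable_sqn Lf) (integrable_sqn Lg)) => //.
Qed.

Definition cintegrable (h : T -> C) :=
  mu.-integrable setT (EFin \o (@complex.Re R \o h)) /\
  mu.-integrable setT (EFin \o (@complex.Im R \o h)).

Lemma cintegrable_sqint f g : square_integrable f -> square_integrable g ->
  cintegrable (fun y => f y * (g y)^*%C).
Proof.
move=> Lf Lg; have [m1 m2] := cmeasurableM Lf.1
  (cmeasurableJ Lg.1).
have ifg := integrable_sqnD Lf Lg.
split; apply: (le_integrable_EFin _ _ ifg).
- exact: m1.
- by move=> y; rewrite -(sqnJ (g y)) norm_ReM_le.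
- exact: m2.
- by move=> y; rewrite -(sqnJ (g y)) norm_ImM_le.
Qed.

Lemma eq_cint (f g : T -> C) : f =1 g -> cint f = cint g.
Proof. by move=> fg; congr cint; exact/funext. Qed.

Lemma cintZ c h : cintegrable h ->
  cint (fun y => c * h y) = c * cint h.
Proof.
move=> [h1 h2]; apply: eq_complexP; rewrite ?cReM ?cImM /=.
- rewrite -!RintegralZl// -RintegralB//.
  + by apply: eq_Rintegral => y _; rewrite cReM.
  + exact: (integrableZl measurableT _ h1).
  + exact: (integrableZl measurableT _ h2).
- rewrite -!RintegralZl// -RintegralD//.
  + by apply: eq_Rintegral => y _; rewrite cImM.
  + exact: (integrableZl measurableT _ h2).
  + exact: (integrableZl measurableT _ h1).
Qed.

Lemma cintB f g : cintegrable f -> cintegrable g ->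
  cint (fun y => f y - g y) = cint f - cint g.
Proof.
move=> [f1 f2] [g1 g2]; apply: eq_complexP;
  rewrite ?cReB ?cImB /= -RintegralB//;
  by apply: eq_Rintegral => y _; rewrite ?cReB ?cImB.
Qed.

Lemma ae_eq_cint f g : cmeasurable f -> cmeasurable g ->
  f = g %[ae mu] -> cint f = cint g.
Proof.
move=> [f1 f2] [g1 g2] fg; congr Complex; congr fine;
  apply: ae_eq_integral => //;
  try exact/measurable_EFinP.
  by apply: filterS fg => y /[apply] /= ->.
by apply: filterS fg => y /[apply] /= ->.
Qed.

Lemma mass_eq0 f : cmeasurable f -> mass f = 0%E -> f = cst 0 %[ae mu].
Proof.
move=> mf f0; have : ae_eq mu setT (EFin \o (fun y => sqn (f y))) (cst 0%E).
  apply/ae_eq_integral_abs => //; first exact/measurable_EFinP/measurable_sqn.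
  rewrite -f0; apply: eq_integral => y _ /=.
  by rewrite ger0_norm// sqn_ge0.
by apply: filterS => y /[apply] -[] /eqP; rewrite sqn_eq0 => /eqP.
Qed.

Lemma ae0_mass f : cmeasurable f -> f = cst 0 %[ae mu] -> mass f = 0%E.
Proof.
move=> mf f0; rewrite -[RHS](@integral0 _ T R mu setT);
  apply: ae_eq_integral => //.
  exact/measurable_EFinP/measurable_sqn.
by apply: filterS f0 => y /[apply] /= ->; rewrite /sqn/= expr0n addr0.
Qed.

Lemma cint_self f : cint (fun y => f y * (f y)^*%C) = (fine (mass f))%:C.
Proof.
apply: eq_complexP => /=.
  by apply: eq_Rintegral => y _; rewrite mulJc.
rewrite /Rintegral (eq_integral (cst 0%E : T -> _)) ?integral0// => y _.
by rewrite mulJc.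
Qed.

Lemma sqint_unimodular u f : cmeasurable u -> (forall y, sqn (u y) = 1) ->
  square_integrable f ->
  square_integrable (fun y => u y * f y) /\ mass (fun y => u y * f y) = mass f.
Proof.
move=> mu_ u1 Lf; have e : mass (fun y => u y * f y) = mass f.
  by apply: eq_integral => y _; rewrite sqnM u1 mul1r.
split=> //; rewrite /square_integrable e; case: Lf => mf ?; split => //.
exact: cmeasurableM.
Qed.

Lemma sqintB f g : square_integrable f -> square_integrable g ->
  square_integrable (fun y => f y - g y).
Proof.
move=> Lf Lg; have [mf mg] := (Lf.1, Lg.1).
have mfg := cmeasurableB mf mg; split => //.
have ifg := integrable_sqnD Lf Lg.
have : mu.-integrable setT (EFin \o (fun y => sqn (f y - g y))).
  (* The dominating function comes from |f - g|^2 <= 2 (|f|^2 + |g|^2). *)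
  apply: (le_integrable_EFin _ _ (integrableZl measurableT 2 ifg)).
    exact: measurable_sqn.
  move=> y; rewrite ger0_norm ?sqn_ge0//.
  case: (f y) (g y) => a b [a' b']; rewrite /sqn/=.
  have := sqr_ge0 (a + a'); have := sqr_ge0 (b + b'); nra.
by move=> /integrable_lty; exact.
Qed.

(** Pointwise, |g - c f|^2 is |c|^2 |f|^2 + |g|^2 minus twice the real part of conj(c) g conj(f);
    integrate with |c| = 1 and equal masses. *)
Lemma mass_sub f g c : square_integrable f -> square_integrable g ->
  mass g = mass f -> sqn c = 1 ->
  mass (fun y => g y - c * f y) =
  (2 * fine (mass f) - 2 * complex.Re (c^*%C * cint (fun y =>
    g y * (f y)^*%C)))%:E.
Proof.
move=> Lf Lg gf c1; have [h1 h2] := cintegrable_sqint Lg Lf.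
have Lcf := (sqint_unimodular (cmeasurable_cst c) (fun=> c1) Lf).1.
have L := sqintB Lg Lcf.
rewrite (sqint_mass L); congr EFin.
have If := integrable_sqn Lf; have Ig := integrable_sqn Lg.
have Ih : mu.-integrable setT
    (EFin \o (fun y => complex.Re (c^*%C * (g y * (f y)^*%C)))).
  have := integrableB measurableT (integrableZl measurableT (complex.Re c) h1)
    (integrableZl measurableT (complex.Im c^*%C) h2).
  by apply: eq_integrable => // y _ /=; rewrite [in RHS]cReM cReJ.
transitivity (\int[mu]_y ((sqn (f y) + sqn (g y)) - 2 * complex.Re (c^*%C * (g
  y * (f y)^*%C)))).
  apply: eq_Rintegral => y _.
  rewrite -[in LHS]/(sqn (g y - c * f y)).
  transitivity (sqn c * sqn (f y) + sqn (g y) - 2 * complex.Re (c^*%C * (g y *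
    (f y)^*%C))).
    case: c {c1 Lcf L Ih} (f y) (g y) => p q [a b] [a' b']; rewrite /sqn/=;
      ring.
  by rewrite c1 mul1r.
rewrite RintegralB//; last 2 first.
- exact: integrable_sqnD.
- exact: (integrableZl measurableT 2 Ih).
rewrite RintegralD// RintegralZl//.
have -> : \int[mu]_y sqn (g y) = fine (mass f) by rewrite -gf.
have -> : \int[mu]_y sqn (f y) = fine (mass f) by [].
rewrite -(cintZ _ (conj h1 h2)) /=; ring.
Qed.

(** Equality case of Cauchy-Schwarz: [c] rotates the inner product onto the nonnegative reals, so
    [mass_sub] makes the mass of g - c f nonpositive, hence zero. *)
Lemma normc_cint_eq f g : square_integrable f -> square_integrable g ->
  mass g = mass f ->
  fine (mass f) <= Normc.normc (cint (fun y => g y * (f y)^*%C)) ->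
  exists2 c : C, sqn c = 1 & g = (fun y => c * f y) %[ae mu].
Proof.
move=> Lf Lg gf le; have [c c1 cE] := unimodular_Re (cint (fun y =>
  g y * (f y)^*%C)).
exists c => //.
have Lcf := (sqint_unimodular (cmeasurable_cst c) (fun=> c1) Lf).1.
have ge := mass_ge0 (fun y => g y - c * f y).
suff : (fun y => g y - c * f y) = cst 0 %[ae mu].
  by apply: filterS => y /[apply] /= /eqP; rewrite subr_eq0 => /eqP.
apply: mass_eq0; first exact: (sqintB Lg Lcf).1.
move: ge; rewrite mass_sub// cE lee_fin => ge.
by congr EFin; apply/eqP; rewrite eq_le ge andbT; lra.
Qed.

End square_integrable.

(** * Time-frequency shifts, their adjoints, and the transforms Q and A *)

Section time_frequency_shift.
Context {R : realType} {d : nat}.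
Local Notation E := 'rV[R]_d.
Local Notation C := R[i].
Local Notation leb := (lebesgue_rV R d).
Local Notation T := (lebesgue_type R d).
Local Open Scope complex_scope.

Lemma expiD (s t : R) : expi (s + t) = expi s * expi t.
Proof.
apply: eq_complexP; rewrite /expi ?cReM ?cImM /= !mulrDr.
  by rewrite cosD.
by rewrite sinD; ring.
Qed.

Lemma expi0 : expi (0 : R) = 1.
Proof. by rewrite /expi mulr0 cos0 sin0. Qed.

Lemma expiN (t : R) : expi (- t) = (expi t)^*%C.
Proof. by rewrite /expi /= mulrN cosN sinN. Qed.

Local Notation cmeas f := (@cmeasurable _ T R f).

Lemma ae_leb_impl (P Q : set E) : (forall y, P y -> Q y) ->
  (\forall y \ae leb, P y) -> \forall y \ae leb, Q y.
Proof.
by move=> PQ; apply: negligibleS => y; apply: contra_not; exact: PQ.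
Qed.

Lemma innerE (f g : E -> C) : inner f g = cint leb (fun y => f y * (g y)^*%C).
Proof. by []. Qed.

(** The square is turned into a power with real exponent, which cancels the root inside [L2norm];
    the value +oo is treated separately. *)
Lemma L2norm_sqr (f : E -> C) : (L2norm f ^+ 2 = mass leb f)%E.
Proof.
transitivity (L2norm f `^ 2)%E.
  have := Lnorm_ge0 leb 2%:E (EFin \o @Normc.normc R \o f).
  rewrite -/(L2norm f); case: (L2norm f) => [r||] // r0.
    by rewrite -EFin_expe poweR_EFin powR_mulrn.
  by rewrite expe2 mulyy poweRyr.
rewrite poweR_Lnorm//; apply: eq_integral => y _ /=.
by rewrite ger0_norm ?normc_ge0// powR_mulrn ?normc_ge0// sqr_normcE.
Qed.

Lemma L2P (f : E -> C) : L2 f <-> square_integrable leb f.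
Proof.
have L : (L2norm f < +oo <-> mass leb f < +oo)%E.
  rewrite -L2norm_sqr; have := Lnorm_ge0 leb 2%:E (EFin \o @Normc.normc R \o f).
  rewrite -/(L2norm f); case: (L2norm f) => [r _|_|//].
    by rewrite -EFin_expe !ltry.
  by rewrite expe2 mulyy.
by split => [[mf1 mf2 /L]|[[mf1 mf2] /L]].
Qed.

Lemma cmeasurable_translate v f : cmeas f -> cmeas (fun y => f (y + v)).
Proof.
by move=> [mf1 mf2]; split;
  [apply: (measurableT_comp mf1)|apply: (measurableT_comp mf2)];
  exact: measurable_lebesgue_translate.
Qed.

Lemma cint_translate v f : cmeas f ->
  cint leb (fun y => f (y + v)) = cint leb f.
Proof.
move=> [f1 f2]; congr Complex; congr fine.
  exact: (integral_translate v ((measurable_EFinP _ _).2 f1)).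
exact: (integral_translate v ((measurable_EFinP _ _).2 f2)).
Qed.

Lemma mass_translate v f : cmeas f ->
  mass leb (fun y => f (y + v)) = mass leb f.
Proof.
move=> mf; apply: (ge0_integral_translate v
  ((measurable_EFinP _ _).2 (measurable_sqn mf))).
by move=> y; rewrite lee_fin sqn_ge0.
Qed.

Lemma sqint_translate v f : square_integrable leb f ->
  square_integrable leb (fun y => f (y + v)).
Proof.
case=> mf fy; split; first exact: cmeasurable_translate.
by rewrite mass_translate.
Qed.

Lemma sqn_expi (t : R) : sqn (expi t) = 1.
Proof. by rewrite /sqn/= cos2Dsin2. Qed.

Lemma normcZ_unit (c z : C) : sqn c = 1 -> Normc.normc (c * z) = Normc.normc z.
Proof.
move=> c1; rewrite Normc.normcM [X in X * _](_ : _ = 1) ?mul1r//.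
by apply/eqP; rewrite -(@eqrXn2 _ 2)// ?normc_ge0// sqr_normcE c1 expr1n.
Qed.

Lemma cmeasurable_expi (phi : E -> R) : measurable_fun [set: T] phi ->
  cmeas (fun y => expi (phi y)).
Proof.
move=> mphi; have m2 : measurable_fun [set: T] (fun y => 2 * pi * phi y).
  exact: measurable_funM.
split; rewrite /comp/=; apply: (measurableT_comp _ m2);
  apply: continuous_measurable_fun;
    [exact: continuous_cos|exact: continuous_sin].
Qed.

Lemma borel_measurable_dot (x : E) : measurable_fun [set: E] (dot x).
Proof.
apply: measurable_sum => i; apply: measurable_funM => //.
exact: measurable_coord.
Qed.

Lemma measurable_dot (x : E) : measurable_fun [set: T] (dot x).
Proof. exact: borel_measurable_fun_lebesgue (borel_measurable_dot x). Qed.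

Lemma dotDr (x y z : E) : dot x (y + z) = dot x y + dot x z.
Proof. by rewrite -big_split; apply: eq_bigr => i _; rewrite mxE mulrDr. Qed.

Lemma dotNr (x y : E) : dot x (- y) = - dot x y.
Proof. by rewrite -sumrN; apply: eq_bigr => i _; rewrite mxE mulrN. Qed.

Lemma dotNl (x y : E) : dot (- x) y = - dot x y.
Proof. by rewrite -sumrN; apply: eq_bigr => i _; rewrite mxE mulNr. Qed.

Lemma dotZr (x y : E) a : dot x (a *: y) = a * dot x y.
Proof. by rewrite /dot mulr_sumr; apply: eq_bigr => i _; rewrite mxE; ring. Qed.

Lemma tf_shift_sqint z f : square_integrable leb f ->
  square_integrable leb (tf_shift z f) /\ mass leb (tf_shift z f) = mass leb f.
Proof.
move=> Lf; have := sqint_unimodular (cmeasurable_expi (measurable_dot z.2))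
  (fun=> sqn_expi _) (sqint_translate (- z.1) Lf).
by rewrite (mass_translate _ Lf.1).
Qed.

(** The inverse of [tf_shift z], and therefore an explicit adjoint, since time-frequency shifts are
    unitary. *)
Definition tf_unshift (z : E * E) (g : E -> C) : E -> C :=
  fun y => expi (- dot z.2 (y + z.1)) * g (y + z.1).

Lemma tf_unshift_sqint z g : square_integrable leb g ->
  square_integrable leb (tf_unshift z g).
Proof.
move=> Lg.
have [Lh _] := sqint_unimodular (cmeasurable_expi (measurable_dot (- z.2)))
  (fun=> sqn_expi _) Lg.
have := sqint_translate z.1 Lh; congr square_integrable.
by apply/funext => y; rewrite /tf_unshift dotNl.
Qed.

(** Translating the integration variable by [z.1] frees [f] from its shift and moves it to [g];
    conjugation accounts for the phase. *)
Lemma tf_shift_adjoint z : is_adjoint (tf_shift z) (tf_unshift z).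
Proof.
split; first by move=> g /L2P Lg; apply/L2P; exact: tf_unshift_sqint.
move=> f g /L2P Lf /L2P Lg.
have [Lsf _] := tf_shift_sqint z Lf.
rewrite !innerE -[LHS](cint_translate z.1 (cmeasurableM Lsf.1 (cmeasurableJ
  Lg.1))).
apply: eq_cint => y; rewrite /tf_shift /tf_unshift addrK conjcM expiN conjcK.
ring.
Qed.

Lemma adjointP (S : (E -> C) -> (E -> C)) :
  (exists T, is_adjoint S T) -> is_adjoint S (adjoint S).
Proof.
move=> ST; rewrite /adjoint; case: pselect => [ST'|/(_ ST)[]].
exact: projT2 (cid ST').
Qed.

(** Since [adjoint] is obtained by choice, it can be compared with [tf_unshift] only almost
    everywhere. For h = U g - V g, both <h, U g> and <h, V g> equal <S h, g>, so <h, h> = 0. *)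
Lemma adjoint_unique (S U V : (E -> C) -> (E -> C)) g :
  is_adjoint S U -> is_adjoint S V -> L2 g -> U g = V g %[ae leb].
Proof.
move=> [LU SU] [LV SV] Lg.
have /L2P LUg := LU _ Lg; have /L2P LVg := LV _ Lg.
pose h := fun y => U g y - V g y.
have Lh : square_integrable leb h by exact: sqintB LUg LVg.
have hh : cint leb (fun y => h y * (h y)^*%C) = 0.
  transitivity (inner h (U g) - inner h (V g)).
    rewrite !innerE -(cintB (cintegrable_sqint Lh LUg) (cintegrable_sqint Lh
      LVg)).
    by apply: eq_cint => y; rewrite conjcB mulrBr.
  by have /L2P LLh := Lh; rewrite -SU// -SV// subrr.
have h0 : h = cst 0 %[ae leb].
  apply: (mass_eq0 Lh.1); rewrite (sqint_mass Lh); congr EFin.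
  by move: hh; rewrite cint_self => -[].
by apply: ae_leb_impl h0 => y /[apply] /= /eqP; rewrite subr_eq0 => /eqP.
Qed.

(** Substituting y - x0/2 for y makes the inner product symmetric; the prefactor is the phase that
    this substitution produces. *)
Lemma ambiguityE z0 f : square_integrable leb f ->
  ambiguity f z0 = expi (- (2^-1 * dot z0.2 z0.1)) * inner (tf_shift (- z0) f)
    f.
Proof.
move=> Lf; have [L _] := tf_shift_sqint (- z0) Lf.
rewrite innerE -(cintZ _ (cintegrable_sqint L Lf)).
rewrite -[RHS](cint_translate (- (2^-1 *: z0.1))); last first.
  apply: cmeasurableM; first exact: cmeasurable_cst.
  exact: cmeasurableM L.1 (cmeasurableJ Lf.1).
apply: eq_cint => y; rewrite /tf_shift/= opprK !mulrA -expiD.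
congr (expi _ * f _ * _).
  by rewrite dotNl dotDr dotNr dotZr; ring.
rewrite -addrA; congr (_ + _).
by apply/rowP => i; rewrite !mxE; field.
Qed.

Lemma normc_ambiguity z0 f : square_integrable leb f ->
  Normc.normc (ambiguity f z0) = Normc.normc (inner (tf_shift (- z0) f) f).
Proof. by move=> Lf; rewrite ambiguityE// normcZ_unit// sqn_expi. Qed.

(** Time-frequency shifts commute up to a phase, so conjugating pi(- z0) by pi(z) only multiplies it
    by a scalar whose exponent is the symplectic form of [z] and [z0]. *)
Lemma QtransE z0 z f : square_integrable leb f ->
  Qtrans (tf_shift (- z0)) f z =
  expi (dot z0.2 z.1 - dot z.2 z0.1) * inner (tf_shift (- z0) f) f.
Proof.
move=> Lf; have [L _] := tf_shift_sqint (- z0) Lf.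
have /L2P Lf' := Lf.
have adj := adjointP (ex_intro _ _ (tf_shift_adjoint z)).
have /L2P Lg := adj.1 _ Lf'.
have m1 := (tf_shift_sqint z (tf_shift_sqint (- z0) Lg).1).1.1.
have m2 := (tf_shift_sqint z (tf_shift_sqint (- z0) (tf_unshift_sqint z
  Lf)).1).1.1.
have mJ := cmeasurableJ Lf.1.
rewrite innerE -(cintZ _ (cintegrable_sqint L Lf)).
transitivity (inner (tf_shift z (tf_shift (- z0) (tf_unshift z f))) f).
  apply: (ae_eq_cint (cmeasurableM m1 mJ) (cmeasurableM m2 mJ)).
  (* At y, [alpha] evaluates the adjoint at y - z.1 + z0.1, so the exceptional null set has to be
     translated accordingly. *)
  have := ae_translate (- z.1 + z0.1) (adjoint_unique adj (tf_shift_adjoint z)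
    Lf').
  apply: ae_leb_impl => y + _ => /(_ I); rewrite addrA => e.
  by rewrite /alpha /tf_shift/= opprK e.
apply: eq_cint => y; rewrite /tf_shift/tf_unshift/= opprK !mulrA -!expiD.
congr (expi _ * f _ * _).
  by rewrite !dotNl !dotDr !dotNr; ring.
by rewrite addrAC subrK.
Qed.

Lemma normc_Qtrans z0 z f : square_integrable leb f ->
  Normc.normc (Qtrans (tf_shift (- z0)) f z) =
  Normc.normc (inner (tf_shift (- z0) f) f).
Proof. by move=> Lf; rewrite QtransE// normcZ_unit// sqn_expi. Qed.

End time_frequency_shift.

(** * Integrable functions invariant under a measure-preserving drift *)

Section invariant.
Context {disp : measure_display} {T : measurableType disp} {R : realType}.
Variable mu : {measure set T -> \bar R}.

(* The integrals of [w] over the sets [t <= l] do not change when [t] increases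
   by 1, so [w] has integral zero over each [- n <= l < n]. *)
Lemma integrable_invariant_eq0 (tau : T -> T) (l w : T -> R) :
  measurable_fun setT tau ->
  (forall A, measurable A -> mu (tau @^-1` A) = mu A) ->
  measurable_fun setT l -> (forall y, l (tau y) = l y + 1) ->
  (forall y, 0 <= w y) -> mu.-integrable setT (EFin \o w) ->
  (\forall y \ae mu, w (tau y) = w y) -> \forall y \ae mu, w y = 0.
Proof.
move=> mtau tauE ml lE w0 iw wE.
have mw : measurable_fun setT w.
  by have /measurable_EFinP := measurable_int _ iw.
pose H t := [set y | t <= l y].
have mH t : measurable (H t).
  rewrite (_ : H t = l @^-1` `[t, +oo[).
    by rewrite -[_ @^-1` _]setTI; apply: ml.
  by apply/seteqP; split => y /=; rewrite in_itv/= andbT.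
pose h t y := w y * \1_(H t) y.
have mh t : measurable_fun setT (h t).
  by apply: measurable_funM => //; exact: measurable_indic.
have h0 t y : 0 <= h t y by rewrite mulr_ge0.
have ih t : mu.-integrable setT (EFin \o h t).
  apply: (le_integrable_EFin _ _ iw) => // y.
  by rewrite ger0_norm// ler_piMr// indicE; case: (_ \in _).
(* Change variables by [tau]: the preimage of [H (t + 1)] is [H t] because [l] grows by 1, and [w]
   is invariant almost everywhere. *)
have hS t : \int[mu]_y h (t + 1) y = \int[mu]_y h t y.
  congr fine.
  transitivity (\int[mu]_y (EFin \o h (t + 1)%R \o tau) y)%E.
    rewrite -[RHS](ge0_integral_pushforward mtau mu measurableT
      ((measurable_EFinP _ _).2 (mh (t + 1)))).
      apply: eq_measure_integral => // D mD _; exact/esym/tauE.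
    by move=> y _; rewrite lee_fin.
  apply: ae_eq_integral => //.
  - exact: measurableT_comp ((measurable_EFinP _ _).2 (mh _)) mtau.
  - exact/measurable_EFinP.
  apply: filterS wE => y wy _ /=; rewrite /h wy; congr (_ * _)%:E.
  rewrite !indicE; congr ((nat_of_bool _)%:R); apply/idP/idP;
    rewrite !inE /H/= lE; lra.
have hn t n : \int[mu]_y h (t + n%:R) y = \int[mu]_y h t y.
  by elim: n => [|n IH]; rewrite ?addr0// -natr1 addrA hS.
have hle n y : h n%:R y <= h (- n%:R) y.
  apply: ler_wpM2l => //; rewrite !indicE ler_nat.
  case: (boolP (y \in H n%:R)) => //; rewrite inE /H/= => ny.
  by rewrite mem_set// /H/= (le_trans _ ny)// ge0_cp.
have key n : \forall y \ae mu, h (- n%:R) y - h n%:R y = 0.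
  have : ae_eq mu setT (EFin \o (fun y => h (- n%:R) y - h n%:R y)) (cst 0%E).
    apply/ae_eq_integral_abs => //.
      by apply/measurable_EFinP; exact: measurable_funB.
    transitivity (\int[mu]_y (EFin \o (fun y =>
      (h (- n%:R) y - h n%:R y)%R)) y)%E.
      by apply: eq_integral => y _ /=; rewrite ger0_norm// subr_ge0.
    have fi : (\int[mu]_y (EFin \o (fun y =>
      (h (- n%:R) y - h n%:R y)%R)) y)%E \is a fin_num.
      apply: integrable_fin_num => //.
      have := integrableB measurableT (ih (- n%:R)) (ih n%:R).
      by apply: eq_integrable.
    rewrite -[LHS]fineK//; congr EFin.
    have := RintegralB measurableT (ih (- n%:R)) (ih n%:R).
    (* 2n unit steps lead from the threshold -n to n, so the two integrals cancel. *)
    rewrite -(hn (- n%:R) (n + n)%N) natrD addrA addNr add0r subrr.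
    exact.
  by apply: filterS => y /(_ I) /= [].
(* Outside a countable union of null sets all strips can be used at once; the one with n > |l y|
   contains [y], and there the difference is [w y]. *)
have := ae_foralln key; apply: filterS => y /(_ (Num.truncn `|l y|).+1).
set n := _.+1; have ly : `|l y| < n%:R.
  by rewrite /n truncnS_gt.
move: ly; rewrite ltr_norml => /andP[l1 l2].
rewrite /h !indicE mem_set ?memNset ?mulr1 ?mulr0 ?subr0// /H /=.
  by apply/negP; rewrite -ltNge.
exact: ltW.
Qed.

End invariant.

(** * Hyperplanes and level sets of characters are null *)

Section hyperplane.
Context {R : realType}.

Lemma dot_cons_rV n (x : 'rV[R]_n.+1) (t : R) (w : 'rV[R]_n) :
  dot x (cons_rV (t, w)) = x 0 0 * t + dot (rsubmx (x : 'rV[R]_(1 + n))) w.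
Proof.
rewrite /dot big_ord_recl; congr (_ + _).
  rewrite /cons_rV !mxE; case: splitP => // j _.
  by rewrite mxE (ord1 j) eqxx mulr1n.
apply: eq_bigr => i _; rewrite !mxE.
have -> : lift ord0 i = rshift 1 i by exact: val_inj.
by case: splitP => j /=; [rewrite (ord1 j)|move=> /eqP;
  rewrite eqn_add2l => /eqP/val_inj ->].
Qed.

(** Induction on the dimension by slicing along the first coordinate. If the tail of [x] is nonzero,
    each slice is a hyperplane of lower dimension; otherwise the set is one point times the whole
    space. *)
Lemma lebesgue_borel_hyperplane n (x : 'rV[R]_n) (a : R) : x != 0 ->
  lebesgue_borel R n [set y | dot x y = a] = 0%E.
Proof.
elim: n x a => [|n IH] x a x0; first by rewrite thinmx0 eqxx in x0.
rewrite /= /lebesgue_cons /pushforward/=.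
pose x' := rsubmx (x : 'rV[R]_(1 + n)).
have [x'0|x'0] := eqVneq x' 0; last first.
  apply: integral0_eq => t _ /=; rewrite -(IH x' (a - x 0 0 * t))//.
  congr (lebesgue_borel R n _); apply/seteqP.
  split => w; rewrite /xsection /= inE /= dot_cons_rV -/x'; lra.
have x00 : x 0 0 != 0.
  apply: contra_neq x0 => x00; apply/rowP => i; rewrite mxE.
  case: (unliftP ord0 i) => [j ->|-> //].
  have -> : lift ord0 j = rshift 1 j by exact: val_inj.
  by move/rowP : x'0 => /(_ j); rewrite !mxE.
rewrite (_ : _ @^-1` _ = [set a / x 0 0] `*` setT).
  transitivity (@lebesgue_measure R [set (a / x 0 0)%R] * lebesgue_borel R n
    setT)%E.
    exact: product_measure1E.
  (* The other factor may be infinite; the convention 0 * oo = 0 applies. *)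
  by rewrite lebesgue_measure_set1 mul0e.
have dot0 w : dot x' w = 0 by rewrite /dot big1// => i _; rewrite x'0 mxE mul0r.
apply/seteqP; split => -[t w] /=; rewrite dot_cons_rV -/x' dot0 addr0.
  by move=> <-; split => //; rewrite mulrAC mulfV// mul1r.
by move=> [-> _]; rewrite mulrC divfK.
Qed.

Lemma expi_nat (k : nat) : expi (k%:R : R) = 1.
Proof.
elim: k => [|k IH]; first exact: expi0.
rewrite -natr1 expiD IH mul1r /expi mulr1 mulrC mulr_natr.
by rewrite cos2pi sin2pi.
Qed.

(** By conjugation s >= 0; let r be its fractional part, so cos (2 pi r) = 1. Injectivity of cos on
    [0, pi] gives r = 0 if r <= 1/2, and applied to 1 - r it excludes r > 1/2. *)
Lemma expi_eq1 (s : R) : expi s = 1 -> exists k : nat, `|s| = k%:R.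
Proof.
wlog s0 : s / 0 <= s => [H s1|s1].
  have [|/ltW] := leP 0 s; first by move/H; exact.
  rewrite -oppr_ge0 => /H; rewrite normrN; apply.
  by rewrite expiN s1 /= oppr0.
exists (Num.truncn s); rewrite ger0_norm//.
have := truncn_itv s0; set k := Num.truncn s; set r := s - k%:R => /andP[ks sk].
have r1 : cos (2 * pi * r) = 1.
  have : expi r = 1.
    have : expi (r + k%:R) = 1 by rewrite subrK.
    by rewrite expiD expi_nat mulr1.
  by case.
have pi0 := pi_gt0 R.
have cos0E (u : R) : 0 <= u <= 2^-1 -> cos (2 * pi * u) = 1 -> u = 0.
  move=> /andP[u0 u1] cu; have : 2 * pi * u = 0.
    apply: cos_inj; rewrite ?cos0// in_itv/=; last by rewrite lexx ltW.
    have -> : 2 * pi * u = pi * (2 * u) by ring.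
    have pi_ge0 := ltW pi0.
    by rewrite mulr_ge0 ?mulr_ge0//= ler_piMr//; lra.
  by move/eqP; rewrite !mulf_eq0 (gt_eqF pi0) pnatr_eq0/= => /eqP.
have [r2|r2] := leP r 2^-1.
  have : r = 0 by apply: cos0E => //; rewrite r2 subr_ge0 ks.
  by rewrite /r; lra.
have rlt1 : r < 1 by move: sk; rewrite -natr1 /r; lra.
suff /eqP : 1 - r = 0 by rewrite subr_eq0 gt_eqF.
apply: cos0E; first by lra.
rewrite mulrBr mulr1 cosB [2 * pi]mulrC mulr_natr cos2pi sin2pi.
by rewrite mul0r addr0 mul1r -mulr_natr [pi * 2]mulrC.
Qed.

(** Fix one point [y1] of the level set: at any other, [dot x] differs from its value at [y1] by an
    integer, so countably many null hyperplanes cover the set. *)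
Lemma expi_level_negligible n (x : 'rV[R]_n) (c : R[i]) : x != 0 ->
  (lebesgue_rV R n).-negligible [set y | expi (dot x y) = c].
Proof.
move=> x0; have [[y1 y1c]|no] := pselect (exists y, expi (dot x y) = c);
  last first.
  apply: (negligibleS _ (negligible_set0 _)) => y yc; case: no; exists y;
    exact: yc.
have hyp a : (lebesgue_rV R n).-negligible [set y | dot x y = a].
  have mhyp : measurable [set y | dot x y = a].
    rewrite (_ : [set _ | _] = dot x @^-1` [set a])//.
    by rewrite -[_ @^-1` _]setTI; exact: borel_measurable_dot.
  exists [set y | dot x y = a]; split => //;
    first exact: borel_measurable_lebesgue.
  by rewrite lebesgue_rV_borel// lebesgue_borel_hyperplane.
apply: (negligibleS _ (negligible_bigcup (fun k : nat =>
  negligibleU (hyp (dot x y1 + k%:R)) (hyp (dot x y1 - k%:R))))).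
move=> y /= yc; have /expi_eq1[k kE] : expi (dot x y - dot x y1) = 1.
  by rewrite expiD expiN yc y1c mulJc -y1c sqn_expi.
exists k => //=; move: kE; case: ger0P => _ <-; [left|right]; lra.
Qed.

End hyperplane.

(** * Absence of eigenvectors and strict Cauchy-Schwarz *)

Section strict_inequality.
Context {R : realType} {d : nat}.
Local Notation E := 'rV[R]_d.
Local Notation C := R[i].
Local Notation leb := (lebesgue_rV R d).

Lemma tf_shift_no_eigenvector (z : E * E) (f : E -> C) (c : C) : z != 0 ->
  square_integrable leb f -> sqn c = 1 ->
  tf_shift z f = (fun y => c * f y) %[ae leb] -> f = cst 0 %[ae leb].
Proof.
case: z => x xi z0 Lf c1 fE; have [x0|x0] := eqVneq x 0.
  have xi0 : xi != 0 by apply: contra_neq z0 => ->; rewrite x0.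
  (* Without translation the equation is expi (xi . y) f y = c f y, so [f] can be nonzero only where
     the phase equals [c]. *)
  have := negligibleU fE (expi_level_negligible c xi0).
  apply: negligibleS => y /= fy; have {fy} f0 : f y <> 0.
    by move=> f0; apply: fy.
  have [yc|yc] := pselect (expi (dot xi y) = c); first by right.
  left => /(_ I); rewrite /tf_shift/= x0 subr0 => e; apply: yc.
  by apply: (mulIf _ e); exact/eqP.
have [i xi0] : exists i, (- x) 0 i != 0.
  apply/existsP; apply: contraNT x0; rewrite negb_exists => /forallP x0.
  by apply/eqP/rowP => i; have := x0 i; rewrite negbK !mxE oppr_eq0 => /eqP.
(* Normalised so that translation by [- x] raises [l] by exactly 1. *)
pose l (y : E) := y 0 i / (- x) 0 i.
have ml : measurable_fun [set: lebesgue_type R d] l.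
  apply: borel_measurable_fun_lebesgue.
  by apply: measurable_funM => //; exact: measurable_coord.
have lE y : l (y - x) = l y + 1 by rewrite /l mxE mulrDl mulfV.
(* Squared moduli remove both the phase and the scalar [c]. *)
have wE : \forall y \ae leb, sqn (f (y - x)) = sqn (f y).
  apply: ae_leb_impl fE => y /(_ I) e.
  by rewrite -[RHS]mul1r -c1 -sqnM -e /tf_shift/= sqnM sqn_expi mul1r.
have := integrable_invariant_eq0 (measurable_lebesgue_translate (- x))
  (fun A _ => lebesgue_rV_translate (- x) A) ml lE
  (fun y => sqn_ge0 (f y)) (integrable_sqn Lf) wE.
by apply: ae_leb_impl => y /eqP; rewrite sqn_eq0 => /eqP.
Qed.

Lemma normc_inner_tf_shift_lt (z : E * E) (f : E -> C) : z != 0 ->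
  square_integrable leb f -> ~ (f = cst 0 %[ae leb]) ->
  Normc.normc (inner (tf_shift z f) f) < fine (mass leb f).
Proof.
move=> z0 Lf f0; have [Lg gf] := tf_shift_sqint z Lf.
rewrite ltNge; apply/negP => le; apply: f0.
have [c c1 e] := normc_cint_eq Lf Lg gf le.
exact: tf_shift_no_eigenvector z0 Lf c1 e.
Qed.

End strict_inequality.

(** * Complex-valued indicator functions *)

Section complex_indicator.
Context {T : Type} {R : realType}.
Implicit Types A B : set T.
Local Open Scope complex_scope.

Definition cindic A (y : T) : R[i] := (\1_A y)%:C.

Lemma cindicI A B y : cindic A y * cindic B y = cindic (A `&` B) y.
Proof. by rewrite /cindic indicI -rmorphM. Qed.

Lemma sqn_cindic A y : sqn (cindic A y) = \1_A y.
Proof. by rewrite /sqn/= expr0n addr0 indicE; case: (_ \in _);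
  rewrite ?expr1n ?expr0n. Qed.

Lemma cindicJ A y : (cindic A y)^*%C = cindic A y.
Proof. exact: conjc_real. Qed.

End complex_indicator.

Section indicator.
Context {disp : measure_display} {T : measurableType disp} {R : realType}.
Variable mu : {measure set T -> \bar R}.
Local Notation cindic := (@cindic T R).
Local Open Scope complex_scope.
Implicit Type A : set T.

Lemma cmeasurable_cindic A : measurable A -> cmeasurable (cindic A).
Proof. by move=> mA; split; [exact: measurable_indic|exact: measurable_cst].
  Qed.

Lemma mass_cindic A u : measurable A -> (forall y, sqn (u y) = 1) ->
  mass mu (fun y => u y * cindic A y) = mu A.
Proof.
move=> mA u1; rewrite /mass -[in RHS](setIT A) -integral_indic//.
by apply: eq_integral => y _; rewrite sqnM u1 mul1r sqn_cindic.
Qed.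

Lemma cint_cindic A : measurable A -> cint mu (cindic A) = (fine (mu A))%:C.
Proof.
move=> mA; apply: eq_complexP => /=; rewrite /Rintegral.
  by rewrite integral_indic ?setIT.
by rewrite integral0_eq.
Qed.

Lemma cintegrable_cindic A : measurable A -> (mu A < +oo)%E ->
  cintegrable mu (cindic A).
Proof.
move=> mA Aoo; split; last exact: integrable0.
apply/integrableP; split; first exact/measurable_EFinP/measurable_indic.
rewrite (eq_integral (fun y => (\1_A y)%:E)) ?integral_indic ?setIT// => y _ /=.
by rewrite ger0_norm.
Qed.

End indicator.

(** * Elementary inequalities for the approximation *)

Section complex_bounds.
Context {R : realType}.

Lemma Re_le_normc (z : R[i]) : complex.Re z <= Normc.normc z.
Proof.
case: z => a b /=; apply: le_trans (ler_norm a) _.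
by rewrite -sqrtr_sqr ler_wsqrtr// lerDl sqr_ge0.
Qed.

(** Weierstrass product inequality. The induction also carries the bounds 0 and 1 on the product. *)
Lemma prod_1B_ge (I : Type) (s : seq I) (a : I -> R) :
  (forall i, 0 <= a i <= 1) -> 1 - \sum_(i <- s) a i <= \prod_(i <- s) (1 - a
    i).
Proof.
move=> a01; suff : 1 - \sum_(i <- s) a i <= \prod_(i <- s) (1 - a i) <= 1 /\
    0 <= \prod_(i <- s) (1 - a i) by case=> /andP[].
elim: s => [|i s [/andP[IH1 IH2] IH3]];
  first by rewrite !big_nil subr0 !lexx ler01.
rewrite !big_cons; have /andP[a0 a1] := a01 i.
by split; [apply/andP; split|]; nra.
Qed.

Lemma cos_near1 (eps : R) : 0 < eps ->
  exists2 del : R, 0 < del & forall t, `|t| <= del -> 1 - eps <= cos t.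
Proof.
move=> e0; have /cvgrPdist_lt /(_ _ e0) [del /= d0 dP] := @continuous_cos R 0.
(* Halving turns the strict neighbourhood into the closed bound on [t]. *)
exists (del / 2); first by rewrite divr_gt0.
move=> t td; have : `|1 - cos t| < eps.
  rewrite -[X in X - _](@cos0 R); apply: dP; rewrite /= sub0r normrN;
    apply: le_lt_trans td _.
  by rewrite ltr_pdivrMr// ltr_pMr// ltr1n.
by rewrite ltr_norml => /andP[_]; lra.
Qed.

End complex_bounds.

(** * Truncated eigenfunctions with quotient close to the bound *)

Section approximate_eigenvectors.
Context {R : realType} {d : nat}.
Local Notation E := 'rV[R]_d.
Local Notation C := R[i].
Local Notation leb := (lebesgue_rV R d).
Local Notation T := (lebesgue_type R d).
Local Open Scope complex_scope.

(** Half-open, to fit [lebesgue_borel_box]. *)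
Definition cube (b : R) : set E := [set x | forall i, 0 < x 0 i <= b].

Lemma measurable_cube b : measurable (cube b : set T).
Proof.
apply: borel_measurable_lebesgue; have := measurable_box (0 : E) (const_mx b).
by congr measurable; apply/seteqP; split=> x /= H i; have := H i; rewrite !mxE.
Qed.

Lemma lebesgue_cube b : 0 <= b -> leb (cube b) = (b ^+ d)%:E.
Proof.
move=> b0.
have e : cube b = [set x : E | forall i,
  (0 : E) 0 i < x 0 i <= (const_mx b : E) 0 i].
  by apply/seteqP; split=> x /= H i; have := H i; rewrite !mxE.
rewrite e lebesgue_rV_borel; last exact: measurable_box.
rewrite lebesgue_borel_box => [|i]; last by rewrite !mxE.
congr EFin; rewrite -[in RHS](card_ord d) -prodr_const.
by apply: eq_bigr => i _; rewrite !mxE subr0.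
Qed.

(** The overlap is again a half-open box, with corners [lo] and [up]; the bound on [x] makes its
    sides nonnegative. *)
Lemma lebesgue_cube_overlap (x : E) b : (forall i, `|x 0 i| <= b) ->
  leb (cube b `&` (fun y => y + x) @^-1` cube b) =
  (\prod_(i < d) (b - `|x 0 i|))%:E.
Proof.
move=> xb; pose lo : E := \row_i Num.max 0 (- x 0 i).
pose up : E := \row_i Num.min b (b - x 0 i).
have e : cube b `&` (fun y => y + x) @^-1` cube b =
    [set y : E | forall i, lo 0 i < y 0 i <= up 0 i].
  apply/seteqP; split => y /=.
    move=> [H1 H2] i; have := H1 i; have := H2 i; rewrite !mxE gt_max le_min.
    by move=> /andP[? ?] /andP[-> ->] /=; lra.
  by move=> H; split=> i; have := H i; rewrite !mxE gt_max le_min; lra.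
have lu i : up 0 i - lo 0 i = b - `|x 0 i|.
  rewrite !mxE /Num.max /Num.min; case: ger0P => xi0; case: ifP; case: ifP; lra.
rewrite e lebesgue_rV_borel; last exact: measurable_box.
rewrite lebesgue_borel_box => [|i]; last by rewrite -subr_ge0 lu subr_ge0.
by congr EFin; apply: eq_bigr => i _; rewrite lu.
Qed.

(* The chirp [expi (a l - a(x) l^2 / 2)], with [a y = xi . y] and [l] linear
   such that [l x = 1], is an eigenfunction of [tf_shift (- (x, xi))] of
   modulus 1; it is truncated to a large cube. *)
Lemma approximate_eigenvector_translation (z : E * E) (eps : R) :
  z.1 != 0 -> 0 < eps ->
  exists f, [/\ square_integrable leb f, (0 < mass leb f)%E &
    (1 - eps) * fine (mass leb f) <= Normc.normc (inner (tf_shift (- z) f) f)].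
Proof.
case: z => x xi x0 e0; rewrite /= in x0.
have [j xj0] : exists j, x 0 j != 0.
  apply/existsP; apply: contraNT x0; rewrite negb_exists => /forallP x0.
  by apply/eqP/rowP => i; have := x0 i; rewrite negbK !mxE => /eqP.
pose S := \sum_i `|x 0 i|; have S0 : 0 <= S by exact: sumr_ge0.
(* The first term yields S / b <= eps, the second makes [b] dominate each |x_i|, and the last makes
   it positive. *)
pose b := S / eps + S + 1.
have Se0 : 0 <= S / eps by rewrite divr_ge0// ltW.
have b0 : 0 < b by rewrite /b; lra.
have xb i : `|x 0 i| <= b.
  have : `|x 0 i| <= S by rewrite /S (bigD1 i)//= lerDl sumr_ge0.
  by rewrite /b; lra.
pose l (y : E) := y 0 j / x 0 j.
pose phi (y : E) := dot xi y * l y - dot xi x * l y ^+ 2 / 2.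
have mphi : measurable_fun [set: T] phi.
  apply: borel_measurable_fun_lebesgue.
  have ml : measurable_fun [set: E] l.
    by apply: measurable_funM => //; exact: measurable_coord.
  apply: measurable_funB.
    by apply: measurable_funM => //; exact: borel_measurable_dot.
  apply: measurable_funM => //; apply: measurable_funM => //.
  exact: measurable_funX.
(* The quadratic term of [phi] cancels the contribution of [dot xi x * l y]; what remains offsets
   the modulation up to a constant phase. *)
have phiE y : phi (y + x) - phi y = dot xi y + dot xi x / 2.
  have lE : l (y + x) = l y + 1 by rewrite /l mxE mulrDl mulfV.
  by rewrite /phi lE dotDr; field.
pose K := cube b; have mK := measurable_cube b.
pose f y := expi (phi y) * cindic K y.
have mf : mass leb f = (b ^+ d)%:E.
  rewrite -(lebesgue_cube (ltW b0)).
  by apply: (mass_cindic leb mK) => y; exact: sqn_expi.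
have Lf : square_integrable leb f.
  split; last by rewrite mf ltry.
  exact: cmeasurableM (cmeasurable_expi mphi) (cmeasurable_cindic mK).
exists f; split => //; first by rewrite mf lte_fin exprn_gt0.
pose A := K `&` (fun y => y + x) @^-1` K.
have mA : measurable (A : set T).
  apply: measurableI => //.
  by have := @measurable_lebesgue_translate _ _ x measurableT _ mK;
    rewrite setTI.
have AE : leb A = (\prod_(i < d) (b - `|x 0 i|))%:E by exact:
  lebesgue_cube_overlap.
have -> : inner (tf_shift (- (x,
  xi)) f) f = expi (dot xi x / 2) * cint leb (cindic A).
  have Aoo : (leb A < +oo)%E by rewrite AE ltry.
  rewrite innerE -(cintZ _ (cintegrable_cindic mA Aoo)).
  apply: eq_cint => y.
  have -> : tf_shift (- (x, xi)) f y = expi (dot (- xi) y) * f (y + x).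
    by rewrite /tf_shift/= opprK.
  rewrite /f conjcM cindicJ -expiN.
  rewrite (_ : cindic A y = cindic K (y + x) * cindic K y); last first.
    by rewrite mulrC -cindicI.
  rewrite (_ : dot xi x / 2 = dot (- xi) y + phi (y + x) - phi y) ?expiD;
    last first.
    by rewrite dotNl -addrA phiE; ring.
  ring.
have cA : cint leb (cindic A) = (fine (leb A))%:C := cint_cindic leb mA.
rewrite normcZ_unit ?sqn_expi// cA AE mf /=.
have prod_ge0 : 0 <= \prod_(i < d) (b - `|x 0 i|).
  by apply: prodr_ge0 => i _; rewrite subr_ge0.
rewrite expr0n addr0 sqrtr_sqr ger0_norm//.
(* The overlap fills a fraction prod (1 - |x_i| / b) of the cube, at least 1 - S / b by
   [prod_1B_ge], hence at least 1 - eps. *)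
rewrite (_ : \prod_(i < d) _ = (\prod_(i < d) (1 - `|x 0 i| / b)) * b ^+ d).
  apply: ler_wpM2r; first by rewrite exprn_ge0 ?ltW.
  have a01 i : 0 <= `|x 0 i| / b <= 1.
    by rewrite divr_ge0 ?(ltW b0)//= ler_pdivrMr// mul1r.
  apply: le_trans (prod_1B_ge _ a01).
  rewrite lerD2l lerN2 -mulr_suml ler_pdivrMr// -/S /b.
  by rewrite !mulrDr mulrCA mulfV ?gt_eqF// mulr1; nra.
have -> : b ^+ d = \prod_(i < d) b by rewrite prodr_const card_ord.
rewrite -big_split/=.
by apply: eq_bigr => i _; rewrite mulrBl mul1r divfK// gt_eqF.
Qed.

(** On a small cube with a corner at the origin the modulation is close to 1, so the indicator of
    the cube is almost fixed; the real part of the inner product suffices for the bound. *)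
Lemma approximate_eigenvector_modulation (xi : E) (eps : R) : 0 < eps ->
  exists f, [/\ square_integrable leb f, (0 < mass leb f)%E &
    (1 - eps) * fine (mass leb f) <=
    Normc.normc (inner (tf_shift (- (0, xi)) f) f)].
Proof.
move=> e0; have [del del0 delP] := cos_near1 e0.
pose S := 2 * pi * \sum_i `|xi 0 i|.
have S0 : 0 <= S by rewrite !mulr_ge0 ?pi_ge0// sumr_ge0.
(* On the cube the angle is at most S b <= del; adding 1 keeps the denominator positive when [xi] is
   0. *)
pose b : R := del / (S + 1).
have S10 : 0 < S + 1 by lra.
have b0 : 0 < b by rewrite divr_gt0.
have bS : S * b <= del by rewrite /b mulrA ler_pdivrMr// mulrC ler_wpM2l; lra.
pose K := cube b; have mK := measurable_cube b.
(* The factor 1 gives [f] the shape expected by [mass_cindic]. *)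
pose f (y : E) : C := 1 * cindic K y.
have mf : mass leb f = (b ^+ d)%:E.
  rewrite -(lebesgue_cube (ltW b0)).
  by apply: (mass_cindic leb mK) => y; rewrite -expi0 sqn_expi.
have Lf : square_integrable leb f.
  split; last by rewrite mf ltry.
  exact: cmeasurableM (cmeasurable_cst 1) (cmeasurable_cindic mK).
exists f; split => //; first by rewrite mf lte_fin exprn_gt0.
apply: le_trans (Re_le_normc _); rewrite innerE.
have [L _] := tf_shift_sqint (- (0, xi)) Lf.
have [iRe _] := cintegrable_sqint L Lf.
have [iK _] := cintegrable_sqint Lf Lf.
have -> : fine (mass leb f) = \int[leb]_y sqn (f y) by [].
rewrite -RintegralZl//; last exact: integrable_sqn Lf.
apply: le_Rintegral => //; first exact: (integrableZl measurableT _
  (integrable_sqn Lf)).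
move=> y _.
have -> : tf_shift (- (0, xi)) f y = expi (dot (- xi) y) * f y.
  by rewrite /tf_shift/= oppr0 subr0.
rewrite /f !mul1r cindicJ -mulrA cindicI setIid sqn_cindic cReM [complex.Im
  (cindic _ _)]/=.
rewrite mulr0 subr0 [complex.Re _]/= [complex.Re _]/=.
rewrite indicE; case: (boolP (y \in K)) => [|_]; last by rewrite !mulr0.
rewrite inE !mulr1 => yK; apply: delP; apply: le_trans bS.
rewrite dotNl mulrN normrN !normrM (ger0_norm (pi_ge0 R)) ger0_norm// /S
  -!mulrA.
rewrite ler_wpM2l// ler_wpM2l ?pi_ge0// mulr_suml.
apply: le_trans (ler_norm_sum _ _ _) _; apply: ler_sum => i _.
rewrite normrM ler_wpM2l//; have /andP[y0 yb] := yK i.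
by rewrite ger0_norm// ltW.
Qed.

Lemma approximate_eigenvector (z : E * E) (eps : R) : 0 < eps ->
  exists f, [/\ square_integrable leb f, (0 < mass leb f)%E &
    (1 - eps) * fine (mass leb f) <= Normc.normc (inner (tf_shift (- z) f) f)].
Proof.
case: z => x xi e0; have [->|x0] := eqVneq x 0.
  exact: approximate_eigenvector_modulation.
exact: approximate_eigenvector_translation.
Qed.

End approximate_eigenvectors.

(** * Evaluation of the two quotients *)

Lemma integral_poweR_cst {disp} {T : measurableType disp} {R : realType}
    (mu : {measure set T -> \bar R}) (D : set T) (g : T -> R) (p c : R) :
  measurable D -> 0 < p -> 0 <= c -> (forall z, g z = c) ->
  ((\int[mu]_(z in D) ((g z `^ p)%R)%:E) `^ p^-1 = mu D `^ p^-1 * c%:E)%E.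
Proof.
move=> mD p0 c0 gc; under eq_integral do rewrite gc.
rewrite integral_cst// poweRM ?lee_fin ?powR_ge0//.
by rewrite poweR_EFin -powRrM mulfV ?gt_eqF// powRr1// muleC.
Qed.

Section quotients.
Context {R : realType} {d : nat}.
Local Notation E := 'rV[R]_d.
Local Notation C := R[i].
Local Notation leb := (lebesgue_rV R d).

Lemma L2_nonzero_mass_gt0 (f : E -> C) : L2_nonzero f -> 0 < fine (mass leb f).
Proof.
move=> [/L2P Lf f0]; rewrite lt_neqAle fine_ge0 ?mass_ge0// andbT eq_sym.
apply/eqP => m0; apply: f0; apply: (mass_eq0 Lf.1).
by rewrite (sqint_mass Lf) m0.
Qed.

Lemma ambiguity_quotientE (z0 : E * E) (m : R) (f : E -> C) : L2_nonzero f ->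
  (m%:E * (Normc.normc (ambiguity f z0))%:E / L2norm f ^+ 2)%E =
  (m * (Normc.normc (inner (tf_shift (- z0) f) f) / fine (mass leb f)))%:E.
Proof.
move=> f0; have N0 := L2_nonzero_mass_gt0 f0; case: f0 => /L2P Lf _.
rewrite L2norm_sqr normc_ambiguity// (sqint_mass Lf) inver gt_eqF//.
by rewrite -!EFinM mulrA.
Qed.

Lemma Qtrans_quotientE (z0 : E * E) (p : R) (Omega : set (E * E)) (f : E -> C) :
  0 < p -> measurable (Omega : set (phase_type R d)) -> L2 f ->
  ((\int[lebesgue_phase R d]_(z in Omega)
      ((Normc.normc (Qtrans (tf_shift (- z0)) f z) `^ p)%R)%:E) `^ p^-1)%E =
  (lebesgue_phase R d Omega `^ p^-1 * (Normc.normc (ambiguity f z0))%:E)%E.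
Proof.
move=> p0 mO /L2P Lf.
apply: (integral_poweR_cst (lebesgue_phase R d) mO p0 (normc_ge0 _)) => z.
by rewrite normc_Qtrans// normc_ambiguity.
Qed.

End quotients.

Theorem proposition4p3 (R : realType) (d : nat) (z0 : 'rV[R]_d * 'rV[R]_d)
    (p : R) (Omega : set ('rV[R]_d * 'rV[R]_d)) :
  z0 != 0 ->
  1 <= p ->
  measurable (Omega : set (phase_type R d)) ->
  (0 < lebesgue_phase R d Omega < +oo)%E ->
  let quotient_Q (f : 'rV[R]_d -> R[i]) : \bar R :=
    ((\int[lebesgue_phase R d]_(z in Omega)
        ((Normc.normc (Qtrans (tf_shift (- z0)) f z) `^ p)%R)%:E) `^ p^-1
      / L2norm f ^+ 2)%E in
  let quotient_A (f : 'rV[R]_d -> R[i]) : \bar R :=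
    (lebesgue_phase R d Omega `^ p^-1 * (Normc.normc (ambiguity f z0))%:E
      / L2norm f ^+ 2)%E in
  let sup_Q := ereal_sup [set quotient_Q f | f in @L2_nonzero R d] in
  let sup_A := ereal_sup [set quotient_A f | f in @L2_nonzero R d] in
  [/\ sup_Q = sup_A,
      sup_A = (lebesgue_phase R d Omega `^ p^-1)%E,
      ~ (exists2 f : 'rV[R]_d -> R[i], L2_nonzero f & quotient_Q f = sup_Q) &
      ~ (exists2 f : 'rV[R]_d -> R[i], L2_nonzero f & quotient_A f = sup_A)].
Proof.
move=> z00 p1 mO /andP[muO0 muOoo] quotient_Q quotient_A sup_Q sup_A.
have p0 : 0 < p by exact: lt_le_trans p1.
have QA f : L2_nonzero f -> quotient_Q f = quotient_A f.
  by move=> [Lf _]; rewrite /quotient_Q Qtrans_quotientE.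
have supE : sup_Q = sup_A.
  congr ereal_sup; apply/seteqP; split => _ [f f0 <-]; exists f => //.
    by rewrite QA.
  by rewrite QA.
(* Since Omega has positive finite measure, |Omega|^(1/p) is a positive real [m], and the
   comparisons can be made between real numbers. *)
have [m m0 mE] : exists2 m : R,
  0 < m & (lebesgue_phase R d Omega `^ p^-1)%E = m%:E.
  have mgt0 := poweR_gt0 p^-1 muO0; have mlty := poweR_lty p^-1 muOoo.
  exists (fine (lebesgue_phase R d Omega `^ p^-1)%E).
    by rewrite fine_gt0// mgt0.
  by rewrite fineK// gt0_fin_numE.
have AE f : L2_nonzero f -> quotient_A f =
    (m * (Normc.normc (inner (tf_shift (- z0) f) f) / fine (mass (lebesgue_rV R
      d) f)))%:E.
  by move=> f0; rewrite /quotient_A mE ambiguity_quotientE.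
have Nz00 : - z0 != 0 by rewrite oppr_eq0.
(* The strict bound gives both the upper estimate of the supremum and its non-attainment. *)
have lt_m f : L2_nonzero f -> (quotient_A f < m%:E)%E.
  move=> f0; rewrite AE// lte_fin -[ltRHS]mulr1 ltr_pM2l//.
  have N0 := L2_nonzero_mass_gt0 f0; case: f0 => /L2P Lf f0.
  by rewrite ltr_pdivrMr// mul1r; exact: normc_inner_tf_shift_lt.
have sup_AE : sup_A = m%:E.
  apply/eqP; rewrite eq_le; apply/andP; split.
    by apply: ub_ereal_sup => _ [f f0 <-]; exact/ltW/lt_m.
  apply/lee_addgt0Pr => e e0.
  (* The relative error e / m becomes [e] after multiplication by [m]. *)
  have [f [Lf f0 fe]] := approximate_eigenvector z0 (divr_gt0 e0 m0).
  have fnz : L2_nonzero f.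
    split; first exact/L2P.
    by move=> f00; move: f0; rewrite (ae0_mass Lf.1 f00) ltxx.
  rewrite -leeBlDr//; apply: le_trans (ereal_sup_ubound _ );
    last by exists f => //; exact: fnz.
  rewrite AE// -EFinB lee_fin.
  have N0 := L2_nonzero_mass_gt0 fnz.
  move: fe; rewrite -ler_pdivlMr// => fe.
  apply: le_trans (ler_wpM2l (ltW m0) fe).
  by rewrite mulrBr mulr1 mulrCA mulfV ?gt_eqF// mulr1.
split => //.
- by rewrite sup_AE mE.
- move=> [f f0]; rewrite supE sup_AE QA// => e; have := lt_m f f0.
  by rewrite e ltxx.
- by move=> [f f0]; rewrite sup_AE => e; have := lt_m f f0; rewrite e ltxx.
Qed.
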